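(* The 16-element set $\{0,1,2,3,4,5,6,7,8,9,10,11,12,13,14,15\}$ is extreme in $\mathbb Z_{17}$.
   Context: $\mathbb Z_n$ denotes the cyclic group of order $n$. For a finite abelian group $G$ with dual group $\Gamma$ and a complex measure $\mu$ on $G$: $\|\mu\|=\sum_{x\in G}|\mu(\{x\})|$, $\widehat\mu(\gamma)=\sum_{x\in G}\overline{\gamma(x)}\,\mu(\{x\})$ for $\gamma\in\Gamma$, and $\|\widehat\mu\|_\infty=\max_\gamma|\widehat\mu(\gamma)|$. A non-zero measure $\mu$ on $G$ is extreme if $\|\widehat\mu\|_\infty=\|\mu\|/\sqrt{\#\mathrm{supp}\,\mu}$. A set $E\subset G$ is extreme if it is the support of an extreme measure on $G$. *)

(* Defs.v *)
From HB Require Import structures.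
From mathcomp Require Import all_boot all_order all_algebra.
From mathcomp Require Import complex.
From mathcomp Require Import all_classical all_reals.

Set Implicit Arguments.
Unset Strict Implicit.
Unset Printing Implicit Defensive.

Import Order.TTheory GRing.Theory Num.Theory.
Import ComplexField.Normc.

Local Open Scope ring_scope.
Local Open Scope complex_scope.
Local Open Scope classical_set_scope.

(* [normc] is the modulus R[i] -> R, whereas `|z| would live in R[i]. *)

Section Extreme.
Context {R : realType} {G : finZmodType}.

(* A complex measure on G is identified with its point masses
   x |-> mu({x}). *)
Definition cmeasure := {ffun G -> R[i]}.

Definition dual : set (G -> R[i]) :=
  [set gamma | (forall x, normc (gamma x) = 1) /\
               {morph gamma : x y / x + y >-> x * y}].

Definition supp (mu : cmeasure) : {set G} := [set x | mu x != 0]%SET.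

Definition mnorm (mu : cmeasure) : R := \sum_(x : G) normc (mu x).

Definition fourier (mu : cmeasure) (gamma : G -> R[i]) : R[i] :=
  \sum_(x : G) (gamma x)^* * mu x.

(* This supremum is a maximum: see [fourier_normP]. *)
Definition fourier_norm (mu : cmeasure) : R :=
  sup [set normc (fourier mu gamma) | gamma in dual].

Definition extreme_measure (mu : cmeasure) : Prop :=
  mu != 0 /\ fourier_norm mu = mnorm mu / Num.sqrt #|supp mu|%:R.

End Extreme.

Arguments cmeasure : clear implicits.

Definition extreme_set (R : realType) (G : finZmodType) (E : {set G}) : Prop :=
  exists2 mu : cmeasure R G, extreme_measure mu & supp mu = E.

Lemma mulrn_card0 (G : finZmodType) (x : G) : x *+ #|G| = 0.
Proof.
apply: (addrI (\sum_(y : G) y)); rewrite addr0.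
rewrite [RHS](reindex_inj (addIr x)) /= big_split /=.
by rewrite big_const iter_addr_0 cardT -cardE.
Qed.

Lemma dual_root1 (R : realType) (G : finZmodType) (gamma : G -> R[i]) (x : G) :
  dual gamma -> gamma x ^+ #|G| = 1.
Proof.
move=> [g1 gD].
have g0 : gamma 0 = 1.
  have nz : gamma 0 != 0.
    apply/eqP => e; have := g1 0; rewrite e normc0 => /esym/eqP.
    by rewrite oner_eq0.
  by apply: (mulfI nz); rewrite -gD addr0 mulr1.
have gM n : gamma (x *+ n) = gamma x ^+ n.
  by elim: n => [|n IH]; rewrite ?mulr0n ?expr0 // mulrS gD IH exprS.
by rewrite -gM mulrn_card0.
Qed.

Lemma fourier_normP (R : realType) (G : finZmodType) (mu : cmeasure R G) :
  (exists2 gamma, dual gamma & normc (fourier mu gamma) = fourier_norm mu) /\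
  (forall gamma, dual gamma -> normc (fourier mu gamma) <= fourier_norm mu).
Proof.
pose n := #|G|.
have n_gt0 : (0 < n)%N by apply/card_gt0P; exists 0.
have [s Ds] := closed_field_poly_normal ('X^n - 1 : {poly R[i]}).
have mem_s z : z ^+ n = 1 -> z \in s.
  move=> zn; have : root ('X^n - 1) z by rewrite rootE !hornerE zn subrr.
  rewrite Ds rootZ ?root_prod_XsubC // lead_coef_eq0.
  by rewrite -size_poly_eq0 size_XnsubC.
pose F (f : {ffun G -> seq_sub s}) x := val (f x).
have surj gamma : dual gamma -> exists f, F f = gamma.
  move=> dg; exists [ffun x => SeqSub (mem_s _ (dual_root1 x dg))].
  by apply/funext => x; rewrite /F ffunE.
have d1 : dual ((fun=> 1) : G -> R[i]).
  by split=> [x|x y]; rewrite ?mulr1 //; exact: normc1.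
have [f0 Df0] := surj _ d1.
have P0 : `[< dual (F f0) >] by apply/asboolP; rewrite Df0.
case: (@Order.TotalTheory.arg_maxP _ _ _ f0 (fun f => `[< dual (F f) >])
  (fun f => normc (fourier mu (F f))) P0) => f /asboolP df fmax.
have ub gamma : dual gamma ->
    normc (fourier mu gamma) <= normc (fourier mu (F f)).
  move=> dg; have [g Dg] := surj _ dg.
  by rewrite -Dg; apply: fmax; apply/asboolP; rewrite Dg.
have Ef : normc (fourier mu (F f)) = fourier_norm mu.
  apply/le_anti/andP; split.
    apply: ub_le_sup; last by exists (F f).
    by exists (normc (fourier mu (F f))) => _ [g dg <-]; exact: ub.
  apply: ge_sup; first by exists (normc (fourier mu (F f))); exists (F f).
  by move=> _ [g dg <-]; exact: ub.
split; first by exists (F f).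
by move=> g dg; rewrite -Ef; exact: ub.
Qed.

(* Main.v *)
Require Import Defs.
From mathcomp Require Import all_boot all_order all_algebra all_field.
From mathcomp Require Import complex all_classical all_reals ring.

Import Order.TTheory GRing.Theory Num.Theory.
Import ComplexField.Normc.

Local Open Scope ring_scope.

(** Removing one point from Z_17 leaves an extreme set because Z_17 is the
    additive group of a finite field F whose order q is 1 modulo 4: for every
    such F and every a in F, the complement of a is extreme.

    By Parseval and Cauchy-Schwarz, extreme measures are, up to scaling, the
    unimodular functions on their support whose Fourier transform has constant
    modulus.  Since the squared modulus of the transform is the transform of
    the autocorrelation, it is constant as soon as the autocorrelation
    vanishes off 0 ([extreme_of_autocorr]).

    With chi the quadratic character of F, the function
      (chi(x)^2 + i sqrt(q-2) chi(x)) / sqrt(q-1)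
    vanishes at 0 and is unimodular elsewhere, as 1 + (q-2) = q-1.  Consider
    q-1 times its autocorrelation at t <> 0.  The chi^2 terms give q-2, which
    counts the x with x and x+t both nonzero, and the chi terms give
    (q-2) * (-1), because the autocorrelation of chi is -1
    ([qchar_autocorr]).  The mixed terms are i sqrt(q-2) times
    chi(-t) - chi(t), which is 0 since -1 is a square in F ([qcharN]): this is
    where q = 1 modulo 4 is used.  Translating by a moves the zero to a; in
    Z_17 the missing point is 16. *)

(** * Flat measures are extreme *)

Section Autocorrelation.
Context {R : realType} {G : finZmodType}.
Implicit Types (mu : cmeasure R G) (gamma : G -> R[i]).

Definition autocorr mu (t : G) : R[i] :=
  \sum_(x : G) mu (x + t) * (mu x)^*%C.

(** Conjugation inverts the values of a character, since they have modulus 1. *)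
Lemma dual_mul_conj gamma (x y : G) :
  dual gamma -> (gamma (x + y))^*%C * gamma x = (gamma y)^*%C.
Proof.
case=> g1 gD; rewrite gD rmorphM /= mulrAC [_^*%C * gamma x]mulrC.
by rewrite -sqr_normc; have -> : `|gamma x| = (normc (gamma x))%:C%C by [];
   rewrite g1 expr1n mul1r.
Qed.

(** Wiener-Khinchin: substituting [x + t] for the first index of the double sum
    that expands the square turns its phase into a function of [t] alone. *)
Lemma sqr_fourier mu gamma : dual gamma ->
  `|fourier mu gamma| ^+ 2 = \sum_(t : G) (gamma t)^*%C * autocorr mu t.
Proof.
move=> dg; rewrite sqr_normc /fourier rmorph_sum /= mulr_sumr.
under [RHS]eq_bigr do rewrite mulr_sumr.
rewrite [RHS]exchange_big /=; apply: eq_bigr => x _.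
rewrite (reindex_inj (addrI x)) mulr_suml /=; apply: eq_bigr => t _.
rewrite -(dual_mul_conj gamma x t dg) rmorphM /= conjcK; ring.
Qed.

(** Only the term [t = 0] survives in the expansion of the squared modulus of
    the transform, and it is the number [n] of points in the support; hence
    the transform has modulus [sqrt n] at every character, while the mass is
    [n]. *)
Lemma extreme_of_autocorr mu : mu != 0 ->
  (forall x, x \in supp mu -> `|mu x| = 1) ->
  (forall t, t != 0 -> autocorr mu t = 0) -> extreme_measure mu.
Proof.
move=> mu0 mu1 ac0; split=> //.
have normE x : normc (mu x) = (x \in supp mu)%:R.
  case: (boolP (x \in supp mu)) => [/mu1 h|]; first by case: h.
  by rewrite inE negbK => /eqP ->; rewrite normc0.
have -> : mnorm mu = #|supp mu|%:R.
  rewrite /mnorm (eq_bigr _ (fun x _ => normE x)) -natr_sum -sum1_card.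
  by rewrite [in RHS]big_mkcond /=; congr (_%:R).
have [[gamma dg <-] _] := fourier_normP mu.
have acE : autocorr mu 0 = #|supp mu|%:R.
  rewrite /autocorr -sum1_card natr_sum [RHS]big_mkcond /=.
  apply: eq_bigr => x _; rewrite addr0 -sqr_normc.
  case: ifP => [/mu1 ->|]; first by rewrite expr1n.
  by rewrite inE => /negbFE/eqP ->; rewrite normr0 expr0n.
have g0 : gamma 0 = 1.
  have := dual_mul_conj gamma 0 0 dg; rewrite addr0 => h.
  have nz : (gamma 0)^*%C != 0.
    by rewrite conjc_eq0; apply/eqP => e; case: dg => /(_ 0)/eqP;
       rewrite e normc0 eq_sym oner_eq0.
  by apply: (mulfI nz); rewrite h mulr1.
have := sqr_fourier mu gamma dg.
rewrite (bigD1 0) //= big1 ?addr0 => [|t /ac0 ->]; last by rewrite mulr0.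
rewrite g0 conjc1 mul1r acE.
have -> : `|fourier mu gamma| = (normc (fourier mu gamma))%:C%C by [].
rewrite -[#|_|%:R in X in X -> _](rmorph_nat (real_complex R)) -rmorphXn /=.
move=> [h]; have F0 : 0 <= normc (fourier mu gamma).
  by case: (fourier mu gamma) => a b; exact: sqrtr_ge0.
rewrite -h sqrtr_sqr ger0_norm // expr2 -mulrA.
have [->|nz] := eqVneq (normc (fourier mu gamma)) 0; first by rewrite mul0r.
by rewrite divff // mulr1.
Qed.

End Autocorrelation.

(** * The quadratic character of a finite field *)

Section QuadraticCharacter.
Context {C : numDomainType} {F : finFieldType}.

(** Euler's criterion serves as the definition, so that multiplicativity comes
    from that of powers. *)
Definition qchar (x : F) : C :=
  if x == 0 then 0 else (-1) ^+ (x ^+ (#|F|.-1)./2 != 1).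

Lemma qchar0 : qchar 0 = 0. Proof. by rewrite /qchar eqxx. Qed.

Lemma sqr_qchar x : qchar x ^+ 2 = (x != 0)%:R.
Proof. by rewrite /qchar; case: ifP; rewrite ?expr0n ?sqrr_sign. Qed.

Lemma predn_card_double : odd #|F| -> #|F|.-1 = ((#|F|.-1)./2 * 2)%N.
Proof.
by move=> F_odd; rewrite muln2 even_halfK //; move: F_odd; case: #|F|.
Qed.

Lemma odd_card_mod4 : (4 %| #|F|.-1)%N -> odd #|F|.
Proof.
move=> F_mod4; rewrite -(prednK (ltnW (finNzRing_gt1 F))) /= -dvdn2.
exact: dvdn_trans F_mod4.
Qed.

Lemma euler_pm1 (x : F) : odd #|F| -> x != 0 ->
  x ^+ (#|F|.-1)./2 = 1 \/ x ^+ (#|F|.-1)./2 = -1.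
Proof.
move=> F_odd x0; have : (x ^+ (#|F|.-1)./2) ^+ 2 == 1.
  rewrite -exprM -predn_card_double // -(inj_eq (mulfI x0)) -exprS mulr1.
  by rewrite prednK ?expf_card // (ltn_trans _ (finNzRing_gt1 F)).
by rewrite sqrf_eq1 => /orP[] /eqP; [left | right].
Qed.

Lemma qcharM (x y : F) : odd #|F| -> qchar (x * y) = qchar x * qchar y.
Proof.
move=> F_odd; rewrite /qchar mulf_eq0; have [->|x0] /= := eqVneq x 0.
  by rewrite mul0r.
have [_|y0] /= := eqVneq y 0; first by rewrite mulr0.
rewrite exprMn; case: (euler_pm1 x F_odd x0) => ->.
  by rewrite mul1r eqxx mul1r.
case: (euler_pm1 y F_odd y0) => ->; first by rewrite mulr1 eqxx mulr1.
by rewrite mulrNN mulr1 eqxx -expr2 sqrr_sign.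
Qed.

Lemma qchar1 : qchar 1 = 1.
Proof. by rewrite /qchar oner_eq0 expr1n eqxx. Qed.

(** Minus 1 is a square: the exponent [(#|F| - 1) / 2] in Euler's criterion is
    even. *)
Lemma qcharN (x : F) : (4 %| #|F|.-1)%N -> qchar (- x) = qchar x.
Proof.
move=> F_mod4; have F_odd := odd_card_mod4 F_mod4.
have /dvdnP[k Dk] := F_mod4.
suff qN1 : qchar (-1) = 1 by rewrite -mulN1r qcharM // qN1 mul1r.
rewrite /qchar oppr_eq0 oner_eq0 -[_ ^+ _./2]signr_odd Dk.
by rewrite -[4%N]/(2 * 2)%N mulnA !muln2 doubleK odd_double eqxx.
Qed.

(** Otherwise [X^((q-1)/2) - 1] would have [q - 1] roots. *)
Lemma nonresidue_exists : odd #|F| -> exists g : F, qchar g = -1.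
Proof.
move=> F_odd; have F_gt1 := finNzRing_gt1 F.
have m_gt0 : (0 < (#|F|.-1)./2)%N.
  by rewrite -double_gt0 -muln2 -predn_card_double // -ltnS prednK // ltnW.
have [/existsP[g /andP[g0 gN1]]|] :=
    boolP [exists g : F, (g != 0) && (g ^+ (#|F|.-1)./2 != 1)].
  by exists g; rewrite /qchar (negPf g0) gN1.
rewrite negb_exists => /forallP all1.
have : (#|predC1 (0%R : F)| <= (#|F|.-1)./2)%N.
  rewrite cardE; apply: max_unity_roots; rewrite ?enum_uniq //.
  apply/allP => x; rewrite mem_enum inE => x0; apply/unity_rootP.
  by have := all1 x; rewrite x0 negbK => /eqP.
rewrite cardC1 [in X in (X <= _)%N]predn_card_double // leqNgt muln2 -addnn.
by rewrite -{1}[_./2]addn0 ltn_add2l m_gt0.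
Qed.

(** Multiplying the index by a nonresidue changes the sign of the sum. *)
Lemma sum_qchar : odd #|F| -> \sum_(x : F) qchar x = 0.
Proof.
move=> F_odd; have [g Dg] := nonresidue_exists F_odd.
have g0 : g != 0.
  by apply: contra_eqN Dg => /eqP ->; rewrite qchar0 eq_sym oppr_eq0 oner_eq0.
suff /eqP : (\sum_(x : F) qchar x) *+ 2 = 0 by rewrite mulrn_eq0 => /eqP.
rewrite mulr2n {1}(reindex_inj (mulfI g0)) /=.
under eq_bigr do rewrite qcharM // Dg mulN1r.
by rewrite sumrN addNr.
Qed.

(** For [x != 0], [chi (x + t) * chi x] is [chi (1 + t / x)], and [1 + t / x]
    takes every value but 1. *)
Lemma qchar_autocorr (t : F) : odd #|F| -> t != 0 ->
  \sum_(x : F) qchar (x + t) * qchar x = -1.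
Proof.
move=> F_odd t0.
(* This inverts [y = 1 + t / x]; as the inverse of 0 is 0, it is a permutation
   of all of [F], which pairs [y = 1] with [x = 0]. *)
have inj : injective (fun y : F => t / (y - 1)).
  by move=> y z /(mulfI t0)/invr_inj/addIr.
rewrite (reindex_inj inj) /= (bigD1 1) //= subrr invr0 mulr0 qchar0 mulr0 add0r.
transitivity (\sum_(y : F | y != 1) qchar y).
  apply: eq_bigr => y y1; have y10 : y - 1 != 0 by rewrite subr_eq0.
  have -> : t / (y - 1) + t = y * (t / (y - 1)) by field.
  rewrite qcharM // -mulrA -expr2 sqr_qchar mulf_neq0 ?invr_eq0 ?mulr1 //.
by have := sum_qchar F_odd; rewrite (bigD1 1) //= qchar1 => /eqP;
   rewrite addrC addr_eq0 => /eqP.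
Qed.

(** The square factor only removes the term [x = - t] from the vanishing full
    sum. *)
Lemma sum_qchar_sqr (t : F) : odd #|F| ->
  \sum_(x : F) qchar x * qchar (x + t) ^+ 2 = - qchar (- t).
Proof.
move=> F_odd; have /eqP := sum_qchar F_odd.
rewrite (bigD1 (- t)) //= addrC addr_eq0 => /eqP <-.
rewrite (bigD1 (- t)) //= addNr qchar0 expr0n mulr0 add0r.
by apply: eq_bigr => x xt; rewrite sqr_qchar addr_eq0 xt mulr1.
Qed.

(** The summand is the indicator of [x] distinct from the two points [0] and
    [- t]. *)
Lemma qchar_sqr_autocorr (t : F) : t != 0 ->
  \sum_(x : F) qchar (x + t) ^+ 2 * qchar x ^+ 2 = #|F|%:R - 2%:R.
Proof.
move=> t0; apply/eqP; rewrite eq_sym subr_eq; apply/eqP.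
rewrite (bigD1 0) //= qchar0 expr0n mulr0 add0r.
rewrite (bigD1 (- t)) ?oppr_eq0 //= addNr qchar0 expr0n mul0r add0r.
rewrite (eq_bigr (fun=> 1)) => [|x /andP[x0 xt]]; last first.
  by rewrite !sqr_qchar addr_eq0 x0 xt mulr1.
rewrite sumr_const -natrD; congr (_%:R).
rewrite -(cardC (pred2 0 (- t))) card2 eq_sym oppr_eq0 t0 addnC.
congr (_ + _)%N.
by apply: eq_card => x; rewrite !inE negb_or.
Qed.

End QuadraticCharacter.

(** * Paley measures *)

Section Paley.
Context {R : realType} {F : finFieldType}.

(** A purely imaginary coefficient makes the cross terms cancel in the modulus;
    its square [2 - #|F|] makes the autocorrelation vanish. *)
Definition paley_coef : R[i] := Complex 0 (Num.sqrt (#|F|%:R - 2%:R)).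

Definition paley_scale : R := (Num.sqrt (#|F|%:R - 1))^-1.

Definition paley (a : F) : cmeasure R F :=
  [ffun x => paley_scale%:C%C *
             (qchar (x - a) ^+ 2 + paley_coef * qchar (x - a))].

Lemma conj_qchar (x : F) : (qchar x : R[i])^*%C = qchar x.
Proof.
by rewrite /qchar; case: ifP; rewrite ?conjc0 // rmorphXn rmorphN1.
Qed.

Lemma conj_paley_coef : paley_coef^*%C = - paley_coef.
Proof. by apply/eqP; rewrite eq_complex /= oppr0 !eqxx. Qed.

Lemma sqr_paley_coef : odd #|F| -> paley_coef ^+ 2 = 2%:R - #|F|%:R.
Proof.
move=> F_odd; have F_ge2 : 0 <= #|F|%:R - 2%:R :> R.
  by rewrite subr_ge0 ler_nat finNzRing_gt1.
rewrite -!(rmorph_nat (real_complex R)) -rmorphB /=; apply/eqP.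
rewrite eq_complex /= !(mul0r, mulr0, addr0) sub0r -expr2 sqr_sqrtr //.
by rewrite opprB !eqxx.
Qed.

Lemma conj_paley (a x : F) :
  (paley a x)^*%C = paley_scale%:C%C *
    (qchar (x - a) ^+ 2 - paley_coef * qchar (x - a)).
Proof.
have conjM (u v : R[i]) : (u * v)^*%C = u^*%C * v^*%C by exact: rmorphM.
have conjD (u v : R[i]) : (u + v)^*%C = u^*%C + v^*%C by exact: rmorphD.
rewrite ffunE conjM conjD expr2 !conjM conj_qchar conj_paley_coef conjc_real.
by rewrite mulNr.
Qed.

Lemma sqr_paley_scale : paley_scale%:C%C ^+ 2 = (#|F|%:R - 1)^-1.
Proof.
rewrite -rmorphXn /= exprVn sqr_sqrtr; last first.
  by rewrite subr_ge0 ler1n ltnW // finNzRing_gt1.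
by rewrite fmorphV rmorphB rmorph1 rmorph_nat.
Qed.

Lemma norm_paley (a x : F) : odd #|F| -> x != a -> `|paley a x| = 1.
Proof.
move=> F_odd xa; apply/eqP; rewrite -(@eqrXn2 _ 2) // expr1n.
rewrite sqr_normc conj_paley ffunE mulrACA -expr2 sqr_paley_scale.
rewrite [(_ + _) * _]mulrC -subr_sqr sqr_qchar subr_eq0 xa expr1n.
rewrite exprMn sqr_paley_coef // sqr_qchar subr_eq0 xa mulr1.
have -> : 1 - (2%:R - #|F|%:R) = #|F|%:R - 1 :> R[i] by ring.
by rewrite mulVf // subr_eq0 pnatr_eq1 gtn_eqF // finNzRing_gt1.
Qed.

(** Both mixed sums equal minus the quadratic character, at [t] and at [- t];
    their difference vanishes because the character is even. *)
Lemma paley_autocorr (a t : F) : (4 %| #|F|.-1)%N -> t != 0 ->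
  autocorr (paley a) t = 0.
Proof.
move=> F_mod4 t0; have F_odd := odd_card_mod4 F_mod4.
rewrite /autocorr (reindex_inj (addIr a)) /=.
(* The first mixed term is written with [x + t - t] in place of [x], so that
   it becomes an instance of the second one after a translation. *)
transitivity (paley_scale%:C%C ^+ 2 *
  \sum_(x : F) (qchar (x + t) ^+ 2 * qchar x ^+ 2
     - paley_coef ^+ 2 * (qchar (x + t) * qchar x)
     + paley_coef * (qchar (x + t) * qchar (x + t - t) ^+ 2
                     - qchar x * qchar (x + t) ^+ 2))).
  rewrite mulr_sumr; apply: eq_bigr => x _.
  rewrite conj_paley ffunE addrAC !addrK; ring.
rewrite big_split /= sumrB -!mulr_sumr sumrB qchar_sqr_autocorr //.
rewrite qchar_autocorr // sum_qchar_sqr // sqr_paley_coef //.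
have -> : \sum_(x : F) qchar (x + t) * qchar (x + t - t) ^+ 2 =
    \sum_(x : F) qchar x * qchar (x - t) ^+ 2 :> R[i].
  by rewrite [RHS](reindex_inj (addIr t)).
rewrite sum_qchar_sqr // opprK qcharN //; ring.
Qed.

Lemma supp_paley (a : F) : odd #|F| -> supp (paley a) = [set~ a]%SET.
Proof.
move=> F_odd; apply/setP => x; rewrite !inE.
have [->|xa] := eqVneq x a.
  by rewrite ffunE subrr qchar0 expr0n mulr0 addr0 mulr0 eqxx.
by rewrite -normr_eq0 norm_paley // oner_eq0.
Qed.

End Paley.

Theorem extreme_setC1 (R : realType) (F : finFieldType) (a : F) :
  (4 %| #|F|.-1)%N -> extreme_set R [set~ a]%SET.
Proof.
move=> F_mod4; have F_odd := odd_card_mod4 F_mod4.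
exists (paley a); last exact: supp_paley.
apply: extreme_of_autocorr => [|x|t t0]; last exact: paley_autocorr.
  apply/eqP => mu0; have : a + 1 \in supp (paley a : cmeasure R F).
    by rewrite supp_paley // !inE -subr_eq0 addrAC subrr add0r oner_eq0.
  by rewrite mu0 inE ffunE eqxx.
by rewrite supp_paley // !inE; apply: norm_paley.
Qed.

(** * The cyclic group of order 17 *)

Theorem proposition7p28 (R : realType) :
  extreme_set R [set (k%:R : 'Z_17) | k : 'I_16]%SET.
Proof.
have -> : [set (k%:R : 'Z_17) | k : 'I_16]%SET = [set~ 16%:R]%SET.
  apply/setP => x; rewrite !inE; apply/imsetP/idP => [[k _ ->]|x16].
    apply/eqP => /(congr1 val); rewrite /= !val_Zp_nat // !modn_small //.
      by have := ltn_ord k => /[swap] ->.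
    by apply: ltn_trans (ltn_ord k) _.
  have xlt : (x < 16)%N.
    rewrite ltn_neqAle -ltnS (ltn_ord x) andbT; apply: contra x16 => /eqP xE.
    by apply/eqP; rewrite -[x]natr_Zp xE.
  by exists (Ordinal xlt); rewrite //= natr_Zp.
(* As 17 is a literal prime, ['F_17] is convertible to ['Z_17]. *)
by apply: (@extreme_setC1 R 'F_17); rewrite card_Fp.
Qed.
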